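(* For $k\ge 1$ let $a_k$ be the number of pairs $(L,C)$ such that $L\subseteq\{1,\dots,k\}$, $C\subseteq\{(j,j+1),(j+1,j): 1\le j\le k-1,\ j\in L,\ j+1\in L\}$, and for every $j$ with $j,j+1\in L$ at least one of $(j,j+1)$, $(j+1,j)$ belongs to $C$. Then $a_1=2$, $a_2=6$, $a_k=4a_{k-1}-2a_{k-2}$ for all $k\ge 3$ (so that $(a_k)_{k\ge1}=(2,6,20,68,232,\dots)$), and $a_k=\Theta\big((2+\sqrt2)^k\big)$.
   Context: These pairs are the states of a deterministic finite automaton $\mathcal{A}_k$ over the alphabet $\{1,\dots,k\}$: in state $(L,C)$, $L$ records the letters read so far and $C$ records which conditions ''some occurrence of $i$ precedes some occurrence of $j$'' (for $j=i\pm1$) have already been fulfilled. This automaton recognizes the words encoding pop-stacked permutations with $k$ runs; $a_k$ is its number of states. *)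

(* Defs.v *)
From HB Require Import structures.
From mathcomp Require Import all_boot all_order all_algebra.
From mathcomp Require Import all_classical all_reals topology normedtype landau.

Set Implicit Arguments.
Unset Strict Implicit.
Unset Printing Implicit Defensive.

Import Order.TTheory GRing.Theory Num.Theory.
Import numFieldNormedType.Exports.

(* The letter i of {1, ..., k} is represented by the ordinal of value i - 1;
   the definitions below only involve the successor relation on letters, which
   is unaffected by this shift. *)

Definition adjacent_pairs (k : nat) (L : {set 'I_k}) : {set 'I_k * 'I_k} :=
  [set p : 'I_k * 'I_k |
    [&& p.1 \in L, p.2 \in L &
        ((p.2 : nat) == p.1.+1) || ((p.1 : nat) == p.2.+1)]].

Definition is_state (k : nat) (s : {set 'I_k} * {set 'I_k * 'I_k}) : bool :=
  let: (L, C) := s in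
  (C \subset adjacent_pairs L) &&
  [forall i : 'I_k, forall j : 'I_k,
     [&& i \in L, j \in L & (j : nat) == i.+1] ==>
       (((i, j) \in C) || ((j, i) \in C))].

Definition num_states (k : nat) : nat :=
  #|[set s : {set 'I_k} * {set 'I_k * 'I_k} | is_state s]|.

(* Main.v *)
(* A state is coded by a word over [bool * bool * bool], whose letter at
   position [j] records whether [j] is in [L], whether [(j - 1, j)] is in [C],
   and whether [(j, j - 1)] is in [C].  Being a state is then a condition on
   consecutive letters, so the numbers [u_k] and [v_k] of valid words of
   length [k] that may follow a letter outside, resp. inside, [L] satisfy
   [u_(k+1) = u_k + v_k] and [v_(k+1) = u_k + 3 v_k].  The matrix of this
   system has trace 4 and determinant 2, hence the recurrence for
   [a_k = u_k], and its eigenvalues give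
   [2 a_k = (2 + sqrt 2)^k + (2 - sqrt 2)^k]. *)

Require Import Defs.
From HB Require Import structures.
From mathcomp Require Import all_boot all_order all_algebra.
From mathcomp Require Import all_classical all_reals topology normedtype landau.
From mathcomp Require Import zify ring lra.

Import Order.TTheory GRing.Theory Num.Theory.
Import numFieldNormedType.Exports.

Lemma card_path_tuple0 (T : finType) (r : rel T) (p : T) :
  #|[set t : 0.-tuple T | path r p t]| = 1.
Proof.
rewrite -(cards1 [tuple of [::] : seq T]); apply: eq_card => t.
by rewrite !inE tuple0 /= eqxx.
Qed.

(** Transfer-matrix step: words are sorted by their first letter [q], and [behead] puts those
    starting with [q] in bijection with the words that may follow [q]. *)
Lemma card_path_tupleS (T : finType) (r : rel T) (n : nat) (p : T) :
  #|[set t : n.+1.-tuple T | path r p t]| =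
    \sum_(q | r p q) #|[set t : n.-tuple T | path r q t]|.
Proof.
rewrite -sum1_card (partition_big (fun t : n.+1.-tuple T => thead t) (r p)).
  apply: eq_bigr => q rpq.
  rewrite -sum1_card (reindex_onto (fun t : n.-tuple T => [tuple of q :: t])
    (fun t => [tuple of behead t])) /=.
    apply: eq_bigl => t; rewrite !inE /= rpq theadE eqxx andbT andbC.
    by rewrite (_ : _ == t) //; apply/eqP/val_inj.
  by move=> t /andP[_ /eqP <-]; case/tupleP: t => x t; apply/val_inj.
by move=> t; case/tupleP: t => x t; rewrite inE theadE /= => /andP[].
Qed.

Definition letter := (bool * bool * bool)%type.

(** Also serves as a fictitious letter before position 0. *)
Definition absent : letter := (false, false, false).

(** One boolean equation carries both conditions on a state: left to right, a pair in [C] needs both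
    letters in [L]; right to left, two neighbours in [L] force at least one pair. *)
Definition compatible : rel letter :=
  fun p q => (q.1.2 || q.2) == (p.1.1 && q.1.1).

Definition decode (k : nat) (t : k.-tuple letter) :
    {set 'I_k} * {set 'I_k * 'I_k} :=
  ([set i | (tnth t i).1.1],
   [set p : 'I_k * 'I_k |
      (((p.2 : nat) == p.1.+1) && (tnth t p.2).1.2) ||
      (((p.1 : nat) == p.2.+1) && (tnth t p.1).2)]).

Definition encode (k : nat) (s : {set 'I_k} * {set 'I_k * 'I_k}) :
    k.-tuple letter :=
  [tuple (i \in s.1,
          [exists j : 'I_k, ((i : nat) == j.+1) && ((j, i) \in s.2)],
          [exists j : 'I_k, ((i : nat) == j.+1) && ((i, j) \in s.2)]) | i < k].

Lemma exists_ord_pred (k : nat) (i j : 'I_k) (P : pred 'I_k) :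
  (j : nat) = i.+1 -> [exists i' : 'I_k, ((j : nat) == i'.+1) && P i'] = P i.
Proof.
move=> ji; apply/existsP/idP => [[i' /andP[/eqP ji']]|Pi].
  by rewrite (_ : i' = i) //; apply/val_inj => /=; lia.
by exists i; rewrite ji eqxx.
Qed.

Lemma exists_ord_pred0 (k : nat) (j : 'I_k) (P : pred 'I_k) :
  (j : nat) = 0 -> [exists i' : 'I_k, ((j : nat) == i'.+1) && P i'] = false.
Proof. by move=> j0; apply/existsP => -[i' /andP[/eqP]]; rewrite j0. Qed.

Variant ord_pred_spec (k : nat) (j : 'I_k) : Prop :=
  | OrdPred0 of (j : nat) = 0
  | OrdPredS (i : 'I_k) of (j : nat) = i.+1.

Lemma ord_predP (k : nat) (j : 'I_k) : ord_pred_spec k j.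
Proof.
case jE: (j : nat) => [|m]; first exact: OrdPred0.
have ltmk : m < k by have := ltn_ord j; lia.
exact: (@OrdPredS k j (Ordinal ltmk)).
Qed.

Lemma path_compatibleP (k : nat) (t : k.-tuple letter) :
  reflect
    ((forall j : 'I_k, (j : nat) = 0 -> compatible absent (tnth t j)) /\
     (forall i j : 'I_k, (j : nat) = i.+1 ->
        compatible (tnth t i) (tnth t j)))
    (path compatible absent t).
Proof.
apply: (iffP (pathP absent)) => [H|[H0 HS] i].
  split=> [j j0|i j ji].
    by have := H j; rewrite size_tuple ltn_ord !(tnth_nth absent) j0; exact.
  by have := H j; rewrite size_tuple ltn_ord !(tnth_nth absent) ji; exact.
rewrite size_tuple => ltik.
have := @ord_predP k (Ordinal ltik) => -[/= i0|j /= ij].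
  by have := H0 (Ordinal ltik) i0; rewrite (tnth_nth absent) /= i0.
have := HS j (Ordinal ltik) ij; rewrite !(tnth_nth absent) /=.
by rewrite ij.
Qed.

(** [decode] can lose only the two flags at position 0, which have no predecessor to refer to;
    compatibility with [absent] forces them to be false. *)
Lemma encodeK (k : nat) (t : k.-tuple letter) :
  path compatible absent t -> encode k (decode k t) = t.
Proof.
move=> /path_compatibleP[H0 _]; apply: eq_from_tnth => j.
rewrite tnth_mktuple /=; case: (ord_predP k j) => [j0|i ji].
  rewrite !exists_ord_pred0 // inE; move: (H0 j j0).
  by case: (tnth t j) => -[[] []] [].
(* With [j = i + 1], the other disjunct of [decode] would require [i = i + 2]. *)
rewrite !(exists_ord_pred _ i) // !inE /= ji eqxx /= ltn_eqF; last by lia.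
by rewrite orbF; case: (tnth t j) => -[].
Qed.

Lemma decode_is_state (k : nat) (t : k.-tuple letter) :
  path compatible absent t -> is_state (decode k t).
Proof.
move=> /path_compatibleP[_ HS]; apply/andP; split.
  apply/fintype.subsetP => -[i j]; rewrite !inE /=.
  case/orP => /andP[/eqP ij h]; rewrite ij eqxx ?orbT andbT.
    by have := HS _ _ ij; rewrite /compatible h => /eqP/esym.
  by have := HS _ _ ij; rewrite /compatible h orbT andbC => /eqP/esym.
apply/forallP => i; apply/forallP => j; apply/implyP.
rewrite !inE /= => /and3P[ti tj /eqP ij].
have := HS _ _ ij; rewrite /compatible ti tj ij eqxx /=.
by rewrite ltn_eqF ?orbF /=; [move=> /eqP | lia].
Qed.

Lemma path_encode (k : nat) (s : {set 'I_k} * {set 'I_k * 'I_k}) :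
  is_state s -> path compatible absent (encode k s).
Proof.
case: s => L C /andP[/fintype.subsetP CL /forallP LC].
apply/path_compatibleP; split=> [j j0|i j ij]; rewrite !tnth_mktuple.
  by rewrite /compatible /= !exists_ord_pred0.
rewrite /compatible /= !(exists_ord_pred _ i) //; apply/eqP; apply/idP/andP.
  by case/orP => /CL; rewrite inE /= => /and3P[].
case=> iL jL; have /forallP/(_ j)/implyP := LC i; apply.
by rewrite iL jL ij /=.
Qed.

Lemma decodeK (k : nat) (s : {set 'I_k} * {set 'I_k * 'I_k}) :
  is_state s -> decode k (encode k s) = s.
Proof.
case: s => L C /andP[/fintype.subsetP CL _].
congr pair; apply/setP; first by move=> i; rewrite inE tnth_mktuple.
case=> i j; rewrite inE /= !tnth_mktuple /=.
case: (eqVneq (j : nat) i.+1) => [ji|nji].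
  by rewrite (exists_ord_pred _ i) // ji ltn_eqF ?orbF //; lia.
case: (eqVneq (i : nat) j.+1) => [ij|nij].
  by rewrite /= (exists_ord_pred _ j).
(* Non-adjacent pairs leave no trace in the code, but a state has none in [C]. *)
by apply/esym/negP => /CL; rewrite inE /= (negbTE nji) (negbTE nij) !andbF.
Qed.

Lemma num_states_path (k : nat) :
  num_states k = #|[set t : k.-tuple letter | path compatible absent t]|.
Proof.
rewrite -(card_in_imset (f := decode k)); last first.
  by apply: (can_in_inj (g := encode k)) => t; rewrite inE; exact: encodeK.
apply: eq_card => s; rewrite inE; apply/idP/imsetP => [ss|[t]].
  by exists (encode k s); rewrite ?decodeK // inE path_encode.
by rewrite inE => /decode_is_state ? ->.
Qed.

Lemma sum_letter (F : letter -> nat) :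
  \sum_q F q =
    F (true, true, true) + F (true, true, false) +
    (F (true, false, true) + F (true, false, false)) +
    (F (false, true, true) + F (false, true, false) +
     (F (false, false, true) + F (false, false, false))).
Proof.
rewrite (eq_bigr (fun q : letter => F (q.1.1, q.1.2, q.2))); last first.
  by case=> -[].
rewrite -(pair_bigA _ (fun x y => F (x.1, x.2, y))) /=.
by rewrite -(pair_bigA _ (fun a b => \sum_y F (a, b, y))) /= !big_bool.
Qed.

Fixpoint follow_counts (k : nat) : nat * nat :=
  if k is k'.+1 then
    let: (u, v) := follow_counts k' in (u + v, u + 3 * v)
  else (1, 1).

(** What may follow [p] depends only on [p.1.1]. A next letter outside [L] has one form, with no
    flags. A next letter inside [L] has one form if [p] is outside [L], and three otherwise, one per
    nonempty choice of flags. *)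
Lemma card_path_compatible (k : nat) (p : letter) :
  #|[set t : k.-tuple letter | path compatible p t]| =
    if p.1.1 then (follow_counts k).2 else (follow_counts k).1.
Proof.
elim: k p => [|k IHk] p; first by rewrite card_path_tuple0 if_same.
rewrite card_path_tupleS (eq_bigr _ (fun q _ => IHk q)) big_mkcond sum_letter.
rewrite /compatible /=; case: (follow_counts k) => u v /=.
by case: p => -[[] b] c /=; lia.
Qed.

Lemma num_statesE (k : nat) : num_states k = (follow_counts k).1.
Proof. by rewrite num_states_path card_path_compatible. Qed.

Local Open Scope classical_set_scope.
Local Open Scope ring_scope.

Lemma num_states_rec (k : nat) :
  (num_states k.+2)%:Z = 4 * (num_states k.+1)%:Z - 2 * (num_states k)%:Z.
Proof. by rewrite !num_statesE /=; case: (follow_counts k) => u v /=; lia. Qed.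

(** The vectors [(1, 1 + s)] and [(1, 1 - s)] are eigenvectors for [2 + s] and [2 - s], and their
    sum is twice the initial vector [(1, 1)]. Both components are needed for the induction. *)
Lemma follow_counts_closed (R : rcfType) (k : nat) (s := Num.sqrt 2 : R) :
  2 * (follow_counts k).1%:R = (2 + s) ^+ k + (2 - s) ^+ k /\
  2 * (follow_counts k).2%:R =
    (1 + s) * (2 + s) ^+ k + (1 - s) * (2 - s) ^+ k.
Proof.
have s2 : s ^+ 2 = 2 by rewrite sqr_sqrtr.
elim: k => [|k]; first by rewrite /= !expr0; split; ring.
rewrite /=; case: (follow_counts k) => u v /= [Eu Ev].
rewrite !exprS !natrD; split.
  by rewrite mulrDr Eu Ev; ring.
by rewrite addr0 !mulrDr Eu Ev; ring: s2.
Qed.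

(** In the closed form, the conjugate term lies between 0 and the dominant term. *)
Lemma num_states_bounds (R : rcfType) (k : nat) :
  (2 + Num.sqrt 2) ^+ k <= 2 * (num_states k)%:R :> R /\
  (num_states k)%:R <= (2 + Num.sqrt 2) ^+ k :> R.
Proof.
have [E _] := follow_counts_closed R k.
have s_ge0 : 0 <= Num.sqrt 2 :> R by exact: sqrtr_ge0.
have s_le2 : Num.sqrt 2 <= 2 :> R.
  by have := sqr_sqrtr (ler0n R 2); nra.
rewrite num_statesE.
have mu_ge0 : 0 <= (2 - Num.sqrt 2) ^+ k :> R by apply: exprn_ge0; lra.
have mu_le : (2 - Num.sqrt 2) ^+ k <= (2 + Num.sqrt 2) ^+ k :> R.
  by apply: lerXn2r; rewrite ?nnegrE; lra.
by split; lra.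
Qed.

Theorem theorem7 (R : realType) :
  [/\ num_states 1 = 2%N /\ num_states 2 = 6%N,
      forall k : nat, (3 <= k)%N ->
        (num_states k)%:Z =
          4 * (num_states (k - 1)%N)%:Z - 2 * (num_states (k - 2)%N)%:Z,
      [/\ num_states 3 = 20%N, num_states 4 = 68%N & num_states 5 = 232%N] &
      (fun k : nat => (num_states k)%:R : R)
        =Theta_\oo (fun k : nat => (2 + Num.sqrt 2) ^+ k : R)].
Proof.
split; rewrite ?num_statesE //.
  by case=> [|[|k]] // _; rewrite subn1 subn2 num_states_rec.
have lam_ge0 k : 0 <= (2 + Num.sqrt 2) ^+ k :> R.
  by apply: exprn_ge0; rewrite addr_ge0 // sqrtr_ge0.
(* The lower estimate becomes a big-O with the two sides exchanged; the constants 1 and 2 are those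
   of [num_states_bounds]. *)
rewrite eqThetaE bigThetaE eqOmegaO; split; apply/eqO_exP.
  exists 1 => //; near=> k.
  by rewrite mul1r !ger0_norm //; have [] := num_states_bounds R k.
exists 2 => //; near=> k.
by rewrite !ger0_norm //; have [] := num_states_bounds R k.
Unshelve. all: by end_near. Qed.
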